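(* Let $\Bbbk$ be an algebraically closed field and let $A=\Bbbk Q/I$ be a finite-dimensional local $\Bbbk$-algebra, where $Q$ is a quiver and $I$ is an admissible ideal of the path algebra $\Bbbk Q$. Then $A$ is of discrete general representation type if and only if $A$ is representation finite.
   Context: An ideal $I\subset \Bbbk Q$ is admissible if $\Bbbk Q_{\geq N}\subset I\subset \Bbbk Q_{\geq 2}$ for some $N\geq 2$, where $\Bbbk Q_{\geq r}$ is the span of paths of length at least $r$. Representation finite means that there are only finitely many isomorphism classes of indecomposable finite-dimensional representations. For $A=\Bbbk Q/I$ and a dimension vector $\mathbf d\colon Q_0\to\mathbb Z_{\geq 0}$, the representation variety $\operatorname{rep}_A(\mathbf d)$ is the closed subvariety of $\prod_{\alpha\in Q_1}\operatorname{Mat}_{\mathbf d(h\alpha),\mathbf d(t\alpha)}(\Bbbk)$ (with $t\alpha$, $h\alpha$ the tail and head of the arrow $\alpha$) consisting of the tuples of matrices satisfying all relations in $I$. The group $GL(\mathbf d)=\prod_{z\in Q_0}GL(\mathbf d(z))$ acts by $g\cdot M=(g_{h\alpha}M_\alpha g_{t\alpha}^{-1})_{\alpha\in Q_1}$. The algebra $A$ is of discrete general representation type if for every dimension vector $\mathbf d$, every irreducible component of $\operatorname{rep}_A(\mathbf d)$ has a dense $GL(\mathbf d)$-orbit. *)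

(* Defs.v *)
From HB Require Import structures.
From mathcomp Require Import all_boot all_algebra.
From mathcomp Require Import boolp classical_sets.
From mathcomp Require Import freeg mpoly.

Set Implicit Arguments.
Unset Strict Implicit.
Unset Printing Implicit Defensive.
Set Warnings "-notation-overridden,-ambiguous-paths".

Import GRing.Theory.

Local Open Scope ring_scope.
Local Open Scope classical_set_scope.
Local Open Scope quotient_scope.

Record quiver := Quiver {
  vertex : finType;
  arrow : finType;
  tl : arrow -> vertex;
  hd : arrow -> vertex }.

Arguments tl {q} a.
Arguments hd {q} a.

(* Paths compose like maps: [cons_walk a p] is the path a p, i.e. first p,
   then a, so that representations below are left modules. *)
Inductive walk (Q : quiver) : vertex Q -> vertex Q -> Type :=
  | nil_walk x : walk x x
  | cons_walk x (a : arrow Q) : walk x (tl a) -> walk x (hd a).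

Arguments nil_walk {Q} x.
Arguments cons_walk {Q x} a _.

Fixpoint walk_length (Q : quiver) (x y : vertex Q) (p : walk x y) : nat :=
  if p is cons_walk _ _ p' then (walk_length p').+1 else 0.

Fixpoint walk_cat (Q : quiver) (x y z : vertex Q) (p : walk y z) :
    walk x y -> walk x z :=
  match p with
  | nil_walk _ => id
  | cons_walk _ a p' => fun q => cons_walk a (walk_cat p' q)
  end.

Record path (Q : quiver) := Path {
  src : vertex Q;
  tgt : vertex Q;
  walk_of : walk src tgt }.

Arguments Path {Q src tgt} walk_of.

HB.instance Definition _ (Q : quiver) := gen_eqMixin (path Q).
HB.instance Definition _ (Q : quiver) := gen_choiceMixin (path Q).

Definition path_length (Q : quiver) (p : path Q) : nat :=
  walk_length (walk_of p).

(* The concatenation p q (first q, then p), when tgt q = src p. *)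
Definition path_cat (Q : quiver) (p q : path Q) : option (path Q) :=
  match tgt q =P src p with
  | ReflectT e => Some (Path (walk_cat (walk_of p)
                    (ecast y (walk (src q) y) e (walk_of q))))
  | ReflectF _ => None
  end.

Definition path_algebra (k : fieldType) (Q : quiver) : Type :=
  {freeg (path Q) / k}.

Section PathAlgebra.
Variables (k : fieldType) (Q : quiver).
Local Notation kQ := (path_algebra k Q).

HB.instance Definition _ := GRing.Lmodule.copy kQ {freeg (path Q) / k}.

Definition of_path (p : path Q) : kQ := << p >>.

Definition mul_path (p q : path Q) : kQ := oapp of_path 0 (path_cat p q).

Definition pa_mul (f g : kQ) : kQ :=
  fglift (fun p => fglift (mul_path p) g) f.

Definition pa_one : kQ := \sum_(x : vertex Q) of_path (Path (nil_walk x)).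

Lemma fglift_sum (M : lmodType k) (F : path Q -> M) (f : kQ) :
  fglift F f = \sum_(p <- dom f) coeff p f *: F p.
Proof.
pose H := GRing.isZmodMorphism.Build _ _ _ (lift_is_additive F).
pose L : {additive {freeg (path Q) / k} -> M} := HB.pack (fglift F) H.
rewrite -[in LHS](freeg_sumE f) -[LHS]/(L _) raddf_sum.
by apply: eq_bigr => p _; rewrite /L /= liftU.
Qed.

Lemma fglift_sumw (M : lmodType k) (F : path Q -> M) (f : kQ) s :
  uniq s -> {subset dom f <= s} ->
  fglift F f = \sum_(p <- s) coeff p f *: F p.
Proof.
move=> us sub; rewrite fglift_sum [RHS](bigID (mem (dom f))) /=.
rewrite [X in _ + X]big1 ?addr0; last first.
  by move=> p /coeff_outdom ->; rewrite scale0r.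
rewrite -[RHS]big_filter; apply: perm_big; apply: uniq_perm.
- exact: uniq_dom.
- exact: filter_uniq.
by move=> p; rewrite mem_filter; case: (boolP (p \in dom f)) => //= /sub.
Qed.

Lemma fglift_linear (M : lmodType k) (F : path Q -> M) :
  linear (fglift F : kQ -> M).
Proof.
move=> c f g; pose s := undup (dom f ++ dom g).
have us : uniq s by apply: undup_uniq.
have sf : {subset dom f <= s} by move=> p pf; rewrite mem_undup mem_cat pf.
have sg : {subset dom g <= s}.
  by move=> p pg; rewrite mem_undup mem_cat pg orbT.
have sfg : {subset dom (c *: f + g) <= s}.
  move=> p; rewrite mem_undup mem_cat !mem_dom coeffD coeffZ.
  apply: contraR; rewrite negb_or !negbK => /andP[/eqP-> /eqP->].
  by rewrite mulr0 addr0.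
rewrite (fglift_sumw _ us sfg) (fglift_sumw _ us sf) (fglift_sumw _ us sg).
rewrite scaler_sumr -big_split; apply: eq_bigr => p _ /=.
by rewrite coeffD coeffZ scalerDl scalerA.
Qed.

HB.instance Definition _ (M : lmodType k) (F : path Q -> M) :=
  GRing.isLinear.Build k kQ M *:%R (fglift F) (fglift_linear F).

Lemma fglift_of_path (M : lmodType k) (F : path Q -> M) p :
  fglift F (of_path p) = F p.
Proof. by rewrite /of_path liftU scale1r. Qed.

Lemma pa_mul_linearl c f1 f2 g :
  pa_mul (c *: f1 + f2) g = c *: pa_mul f1 g + pa_mul f2 g.
Proof. by rewrite /pa_mul linearP. Qed.

Lemma pa_mul_linearr f : linear (pa_mul f).
Proof.
move=> c g1 g2; rewrite /pa_mul !fglift_sum scaler_sumr -big_split.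
apply: eq_bigr => p _ /=.
by rewrite linearP scalerDr !scalerA [c * _]mulrC.
Qed.

HB.instance Definition _ f :=
  GRing.isLinear.Build k kQ kQ *:%R (pa_mul f) (pa_mul_linearr f).

Lemma pa_0mul g : pa_mul 0 g = 0.
Proof. by rewrite /pa_mul linear0. Qed.

Lemma pa_mul0 f : pa_mul f 0 = 0.
Proof. exact: linear0. Qed.

Lemma pa_mul_of_path p q : pa_mul (of_path p) (of_path q) = mul_path p q.
Proof. by rewrite /pa_mul !fglift_of_path. Qed.

Lemma path_algebra_ind (P : kQ -> Prop) :
  (forall c f g, P f -> P g -> P (c *: f + g)) ->
  P 0 -> (forall p, P (of_path p)) -> forall f, P f.
Proof.
move=> Plin P0 Pp f; have -> : f = \sum_(p <- dom f) coeff p f *: of_path p.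
  rewrite -[in LHS](freeg_sumE f); apply: eq_bigr => p _.
  by apply/eqP/freeg_eqP => q; rewrite coeffZ !coeffU mul1r.
elim: (dom f) => [|p s IHs]; first by rewrite big_nil.
by rewrite big_cons; apply: Plin.
Qed.

Lemma walk_catA (x y z w : vertex Q)
    (p : walk z w) (q : walk y z) (r : walk x y) :
  walk_cat p (walk_cat q r) = walk_cat (walk_cat p q) r.
Proof. by elim: p y q r => //= {z w} z a p IHp y q r; rewrite IHp. Qed.

Lemma walk_cat0 (x y : vertex Q) (p : walk x y) : walk_cat p (nil_walk x) = p.
Proof. by elim: p => //= {x y} x a p ->. Qed.

Lemma path_catE (x y z : vertex Q) (p : walk y z) (q : walk x y) :
  path_cat (Path p) (Path q) = Some (Path (walk_cat p q)).
Proof.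
by rewrite /path_cat; case: eqP => //= e; rewrite eq_axiomK.
Qed.

Lemma path_cat_None (p q : path Q) : tgt q != src p -> path_cat p q = None.
Proof. by rewrite /path_cat; case: eqP. Qed.

Lemma path_catA (p q r : path Q) :
  obind (fun s => path_cat p s) (path_cat q r) = obind (fun s => path_cat s r) (path_cat p q).
Proof.
case: p q r => [z w p] [y z' q] [x y' r].
have [e|nqr] := eqVneq y' y; last first.
  rewrite [path_cat _ (Path r)]path_cat_None //=.
  have [e|npq] := eqVneq z' z; last by rewrite path_cat_None.
  by subst z'; rewrite path_catE /= path_cat_None.
subst y'; rewrite path_catE /=.
have [e|npq] := eqVneq z' z; last by rewrite !path_cat_None.
by subst z'; rewrite !path_catE /= path_catE walk_catA.
Qed.

Lemma pa_mulA : associative pa_mul.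
Proof.
move=> f g h; elim/path_algebra_ind: f => [c f f' IHf IHf'| |p].
- by rewrite !pa_mul_linearl IHf IHf'.
- by rewrite !pa_0mul.
elim/path_algebra_ind: g => [c g g' IHg IHg'| |q].
- by rewrite pa_mul_linearl !pa_mul_linearr pa_mul_linearl IHg IHg'.
- by rewrite pa_0mul !pa_mul0 pa_0mul.
elim/path_algebra_ind: h => [c h h' IHh IHh'| |r].
- by rewrite !pa_mul_linearr IHh IHh'.
- by rewrite !pa_mul0.
rewrite !pa_mul_of_path /mul_path; move: (path_catA p q r).
case: (path_cat q r) (path_cat p q) => [qr|] [pq|] //= e.
- by rewrite !pa_mul_of_path /mul_path e.
- by rewrite pa_mul_of_path pa_0mul /mul_path e.
- by rewrite pa_mul_of_path pa_mul0 /mul_path -e.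
- by rewrite pa_mul0 pa_0mul.
Qed.

Lemma pa_mul1 : left_id pa_one pa_mul.
Proof.
move=> f; elim/path_algebra_ind: f => [c f g IHf IHg| |[x y p]].
- by rewrite pa_mul_linearr IHf IHg.
- exact: pa_mul0.
rewrite /pa_one /pa_mul linear_sum (bigD1 y) //= !fglift_of_path.
rewrite {1}/mul_path path_catE /= big1 ?addr0 // => z nzy.
by rewrite !fglift_of_path /mul_path path_cat_None //= eq_sym.
Qed.

Lemma pa_1mul : right_id pa_one pa_mul.
Proof.
move=> f; elim/path_algebra_ind: f => [c f g IHf IHg| |[x y p]].
- by rewrite pa_mul_linearl IHf IHg.
- exact: pa_0mul.
rewrite /pa_one linear_sum (bigD1 x) //= pa_mul_of_path.
rewrite {1}/mul_path path_catE /= walk_cat0 big1 ?addr0 // => z nzx.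
by rewrite pa_mul_of_path /mul_path path_cat_None.
Qed.

Lemma pa_mulDl : left_distributive pa_mul +%R.
Proof. by move=> f g h; rewrite /pa_mul linearD. Qed.

Lemma pa_mulDr : right_distributive pa_mul +%R.
Proof. by move=> f g h; rewrite linearD. Qed.

HB.instance Definition _ := GRing.Zmodule_isPzRing.Build kQ
  pa_mulA pa_mul1 pa_1mul pa_mulDl pa_mulDr.

Lemma pa_scalerAl (c : k) (f g : kQ) : c *: (f * g) = (c *: f) * g.
Proof. by rewrite -[RHS]/(pa_mul _ _) /pa_mul linearZ. Qed.

Lemma pa_scalerAr (c : k) (f g : kQ) : c *: (f * g) = f * (c *: g).
Proof. by rewrite -[RHS]/(pa_mul _ _) linearZ. Qed.

(* The span of the paths of length at least r: [dom f] is the support of f. *)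
Definition paths_ge (r : nat) : set kQ :=
  [set f | forall p, p \in dom f -> (r <= path_length p)%N].

End PathAlgebra.

Record ideal (R : pzRingType) := Ideal {
  ideal_set : set R;
  ideal0 : ideal_set 0;
  idealB : forall x y, ideal_set x -> ideal_set y -> ideal_set (x - y);
  idealMl : forall a x, ideal_set x -> ideal_set (a * x);
  idealMr : forall a x, ideal_set x -> ideal_set (x * a) }.

(* The library quotients by boolean subgroups: [ideal_pred I] is
   the boolean reflection of I; the ring structure for noncommutative kQ is
   added on top of the library's additive quotient. *)
Section QuotientAlgebra.
Variables (k : fieldType) (Q : quiver) (I : ideal (path_algebra k Q)).
Local Notation kQ := (path_algebra k Q).

Definition ideal_pred : {pred kQ} := fun f => `[< ideal_set I f >].

Lemma ideal_predP f : reflect (ideal_set I f) (f \in ideal_pred).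
Proof. exact: asboolP. Qed.

Lemma ideal_pred_zmod_closed : zmod_closed ideal_pred.
Proof.
split=> [|f g /ideal_predP If /ideal_predP Ig]; apply/ideal_predP.
  exact: ideal0.
exact: idealB.
Qed.

HB.instance Definition _ :=
  GRing.isZmodClosed.Build kQ ideal_pred ideal_pred_zmod_closed.

Definition quotient_algebra : Type := Quotient.quot ideal_pred.
Local Notation A := quotient_algebra.

HB.instance Definition _ := GRing.Zmodule.copy A (Quotient.quot ideal_pred).

Definition qproj (f : kQ) : A := \pi_(Quotient.quot ideal_pred) f.

Definition qrepr (u : A) : kQ := repr (u : Quotient.quot ideal_pred).

Lemma qreprK : cancel qrepr qproj.
Proof. exact: reprK. Qed.

Lemma qprojP f g : qproj f = qproj g <-> ideal_set I (f - g).
Proof.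
split=> [/eqP|Ifg]; first by rewrite /qproj -Quotient.idealrBE => /ideal_predP.
by apply/eqP; rewrite /qproj -Quotient.idealrBE; apply/ideal_predP.
Qed.

Lemma qprojD : {morph qproj : f g / f + g}.
Proof. exact: Quotient.pi_add. Qed.

Definition qa_mul (u v : A) : A := qproj (qrepr u * qrepr v).
Definition qa_scale (c : k) (u : A) : A := qproj (c *: qrepr u).
Definition qa_one : A := qproj 1.

Lemma qprojM f g : qproj (f * g) = qa_mul (qproj f) (qproj g).
Proof.
apply/qprojP; set f' := qrepr _; set g' := qrepr _.
have If : ideal_set I (f - f') by apply/qprojP; rewrite qreprK.
have Ig : ideal_set I (g - g') by apply/qprojP; rewrite qreprK.
have -> : f * g - f' * g' = (f - f') * g - f' * (g' - g).
  by rewrite mulrBl mulrBr opprB addrA subrK.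
apply: idealB; first exact: idealMr.
by apply: idealMl; rewrite -opprB -sub0r; apply: idealB => //; apply: ideal0.
Qed.

Lemma qprojZ c f : qproj (c *: f) = qa_scale c (qproj f).
Proof.
apply/qprojP; set f' := qrepr _.
have If : ideal_set I (f - f') by apply/qprojP; rewrite qreprK.
by rewrite -scalerBr -[f - f']mul1r pa_scalerAl; apply: idealMl.
Qed.

Lemma qa_mulA : associative qa_mul.
Proof.
move=> u v w; rewrite -[u]qreprK -[v]qreprK -[w]qreprK -!qprojM.
by rewrite mulrA.
Qed.

Lemma qa_mul1 : left_id qa_one qa_mul.
Proof. by move=> u; rewrite -[u]qreprK -qprojM mul1r. Qed.

Lemma qa_1mul : right_id qa_one qa_mul.
Proof. by move=> u; rewrite -[u]qreprK -qprojM mulr1. Qed.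

Lemma qa_mulDl : left_distributive qa_mul +%R.
Proof.
move=> u v w; rewrite -[u]qreprK -[v]qreprK -[w]qreprK.
by rewrite -!(qprojM, qprojD) mulrDl.
Qed.

Lemma qa_mulDr : right_distributive qa_mul +%R.
Proof.
move=> u v w; rewrite -[u]qreprK -[v]qreprK -[w]qreprK.
by rewrite -!(qprojM, qprojD) mulrDr.
Qed.

HB.instance Definition _ := GRing.Zmodule_isPzRing.Build A
  qa_mulA qa_mul1 qa_1mul qa_mulDl qa_mulDr.

Lemma qa_scaleA b c u : qa_scale b (qa_scale c u) = qa_scale (b * c) u.
Proof. by rewrite -[u]qreprK -!qprojZ scalerA. Qed.

Lemma qa_scale1 : left_id 1 qa_scale.
Proof. by move=> u; rewrite -[u]qreprK -!qprojZ scale1r. Qed.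

Lemma qa_scaleDr : right_distributive qa_scale +%R.
Proof.
move=> c u v; rewrite -[u]qreprK -[v]qreprK.
by rewrite -!(qprojZ, qprojD) scalerDr.
Qed.

Lemma qa_scaleDl u : {morph qa_scale^~ u : b c / b + c}.
Proof.
by move=> b c; rewrite -[u]qreprK -!(qprojZ, qprojD) scalerDl.
Qed.

HB.instance Definition _ := GRing.Zmodule_isLmodule.Build k A
  qa_scaleA qa_scale1 qa_scaleDr qa_scaleDl.

End QuotientAlgebra.

Definition right_ideal (R : pzRingType) (J : set R) : Prop :=
  [/\ J 0, (forall x y, J x -> J y -> J (x - y))
    & forall x a, J x -> J (x * a)].

Definition maximal_right_ideal (R : pzRingType) (J : set R) : Prop :=
  [/\ right_ideal J, ~ J 1
    & forall J' : set R, right_ideal J' -> ~ J' 1 -> J `<=` J' -> J' = J].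

Definition local_ring (R : pzRingType) : Prop :=
  exists! J : set R, maximal_right_ideal J.

Definition finite_dimensional (k : fieldType) (V : lmodType k) : Prop :=
  exists (n : nat) (b : 'I_n -> V),
    forall v : V, exists c : 'I_n -> k, v = \sum_(i < n) c i *: b i.

Definition admissible (k : fieldType) (Q : quiver)
    (I : ideal (path_algebra k Q)) : Prop :=
  exists N : nat, [/\ (2 <= N)%N,
    paths_ge N `<=` ideal_set I
    & ideal_set I `<=` paths_ge 2].

Section Representations.
Variables (k : fieldType) (Q : quiver).

Definition rep_space (d : vertex Q -> nat) : Type :=
  forall a : arrow Q, 'M[k]_(d (hd a), d (tl a)).

Fixpoint walk_mx d (M : rep_space d) (x y : vertex Q) (p : walk x y) :
    'M[k]_(d y, d x) :=
  match p with
  | nil_walk _ => 1%:M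
  | cons_walk _ a p' => M a *m walk_mx M p'
  end.

(* The (y, x) block of the action of p on the direct sum of the spaces at the
   vertices: zero unless p goes from x to y. *)
Definition path_mx d (M : rep_space d) (p : path Q) (x y : vertex Q) :
    'M[k]_(d y, d x) :=
  match src p =P x, tgt p =P y with
  | ReflectT ex, ReflectT ey =>
      castmx (congr1 d ey, congr1 d ex) (walk_mx M (walk_of p))
  | _, _ => 0
  end.

Definition eval_rep d (M : rep_space d) (f : path_algebra k Q)
    (x y : vertex Q) : 'M[k]_(d y, d x) :=
  \sum_(p <- dom f) coeff p f *: path_mx M p x y.

Variable I : ideal (path_algebra k Q).

Definition rep_variety (d : vertex Q -> nat) : set (rep_space d) :=
  [set M | forall f, ideal_set I f -> forall x y, eval_rep M f x y = 0].

Arguments rep_variety d : clear implicits.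

Definition GL_orbit d (M : rep_space d) : set (rep_space d) :=
  [set N | exists g : forall x, 'M[k]_(d x), (forall x, g x \in unitmx) /\
    forall a, N a = g (hd a) *m M a *m invmx (g (tl a))].

(* [rep_space d] is an affine space whose coordinates are the matrix entries;
   [zariski_closed] and [irreducible_set] refer to its Zariski topology, which
   induces that of the closed subvariety [rep_variety d]. *)
Definition coordinate (d : vertex Q -> nat) : finType :=
  {a : arrow Q & ('I_(d (hd a)) * 'I_(d (tl a)))%type}.

Definition coordinates d (M : rep_space d) (i : 'I_#|coordinate d|) : k :=
  let c := enum_val i in M (tag c) (tagged c).1 (tagged c).2.

Definition zariski_closed d (X : set (rep_space d)) : Prop :=
  exists S : set {mpoly k[#|coordinate d|]},
    X = [set M | forall p, S p -> p.@[coordinates M] = 0].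

Definition irreducible_set d (Z : set (rep_space d)) : Prop :=
  Z !=set0 /\ forall F G, zariski_closed F -> zariski_closed G ->
    Z `<=` F `|` G -> Z `<=` F \/ Z `<=` G.

Definition irreducible_component d (X Z : set (rep_space d)) : Prop :=
  [/\ Z `<=` X, irreducible_set Z
    & forall Z', irreducible_set Z' -> Z' `<=` X -> Z `<=` Z' -> Z' = Z].

Definition has_dense_orbit d (Z : set (rep_space d)) : Prop :=
  exists M, [/\ Z M, GL_orbit M `<=` Z
    & forall F, zariski_closed F -> GL_orbit M `<=` F -> Z `<=` F].

Definition discrete_general_rep_type : Prop :=
  forall (d : vertex Q -> nat) (Z : set (rep_space d)),
    irreducible_component (rep_variety d) Z -> has_dense_orbit Z.

Record rep := Rep {
  dimv : vertex Q -> nat;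
  rep_mx : rep_space dimv }.

Definition is_module (V : rep) : Prop := rep_variety (dimv V) (rep_mx V).

(* Two-sided inverse families of rectangular matrices: representations with
   propositionally equal dimension vectors are compared without casts. *)
Definition rep_iso (V W : rep) : Prop :=
  exists (f : forall x, 'M[k]_(dimv W x, dimv V x))
         (g : forall x, 'M[k]_(dimv V x, dimv W x)),
    [/\ forall x, g x *m f x = 1%:M, forall x, f x *m g x = 1%:M
      & forall a, f (hd a) *m rep_mx V a = rep_mx W a *m f (tl a)].

Definition direct_sum (V W : rep) : rep :=
  @Rep (fun x => dimv V x + dimv W x)%N
    (fun a => block_mx (rep_mx V a) 0 0 (rep_mx W a)).

Definition rep_zero (V : rep) : Prop := forall x, dimv V x = 0%N.

Definition indecomposable (V : rep) : Prop :=
  ~ rep_zero V /\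
  forall V1 V2, is_module V1 -> is_module V2 ->
    rep_iso V (direct_sum V1 V2) -> rep_zero V1 \/ rep_zero V2.

Definition representation_finite : Prop :=
  exists (n : nat) (W : 'I_n -> rep),
    forall V, is_module V -> indecomposable V -> exists i, rep_iso V (W i).

End Representations.

(* Main.v *)
(* A local admissible quotient has a one-vertex quiver, and the number of loops
   decides both properties.  With at most one loop, modules are nilpotent
   matrices: by the Jordan form each dimension has finitely many orbits, so each
   component is the closure of one of them, and the indecomposables are Jordan
   blocks of bounded size.  With two loops, rep_A(2) consists of the tuples of
   multiples of one nilpotent 2 x 2 matrix; it is irreducible, and the ratio of
   the multiples at two loops is an orbit invariant with infinitely many values,
   so no orbit is dense and the modules with distinct ratios give infinitely
   many indecomposables. *)

Require Import Defs.
From mathcomp Require Import all_boot all_algebra.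
From mathcomp Require Import boolp classical_sets.
From mathcomp Require Import freeg mpoly.
From mathcomp Require Import zify ring.
Import Defs.

Set Implicit Arguments.
Unset Strict Implicit.
Unset Printing Implicit Defensive.

Import GRing.Theory.

Local Open Scope ring_scope.
Local Open Scope classical_set_scope.

(** * Nilpotent matrices *)

Section Conjugacy.
Variable k : fieldType.

(* The sizes are not assumed equal, so that block decompositions need no
   casts. *)
Definition similar_mx m n (A : 'M[k]_m) (B : 'M[k]_n) : Prop :=
  exists (f : 'M_(n, m)) (g : 'M_(m, n)),
    [/\ g *m f = 1%:M, f *m g = 1%:M & f *m A = B *m f].

Lemma similar_mx_size m n (A : 'M[k]_m) (B : 'M[k]_n) :
  similar_mx A B -> m = n.
Proof.
case=> f [g [gf fg _]]; apply/eqP.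
by rewrite eqn_leq (mulmx1_min gf) (mulmx1_min fg).
Qed.

Lemma similar_mx_refl m (A : 'M[k]_m) : similar_mx A A.
Proof. by exists 1%:M, 1%:M; rewrite !mulmx1 !mul1mx. Qed.

Lemma similar_mx_sym m n (A : 'M[k]_m) (B : 'M[k]_n) :
  similar_mx A B -> similar_mx B A.
Proof.
case=> f [g [gf fg fA]]; exists g, f; split=> //.
by rewrite -[g *m B]mulmx1 -fg mulmxA -(mulmxA g) -fA mulmxA gf mul1mx.
Qed.

Lemma similar_mx_trans m n p (A : 'M[k]_m) (B : 'M[k]_n) (C : 'M[k]_p) :
  similar_mx A B -> similar_mx B C -> similar_mx A C.
Proof.
case=> f [g [gf fg fA]] [f' [g' [gf' fg' fB]]]; exists (f' *m f), (g *m g').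
split.
- by rewrite mulmxA -(mulmxA g) gf' mulmx1.
- by rewrite mulmxA -(mulmxA f') fg mulmx1.
- by rewrite -mulmxA fA !mulmxA fB.
Qed.

Lemma similar_block_mx m n p (A : 'M[k]_p) (B : 'M[k]_m) (C : 'M[k]_n) :
  similar_mx B C -> similar_mx (block_mx A 0 0 B) (block_mx A 0 0 C).
Proof.
case=> f [g [gf fg fA]].
exists (block_mx 1%:M 0 0 f), (block_mx 1%:M 0 0 g).
by split; rewrite !mulmx_block !(mulmx0, mul0mx, addr0, add0r, mul1mx, mulmx1)
  ?gf ?fg ?fA // -scalar_mx_block.
Qed.

Lemma similar_mxX m n (A : 'M[k]_m) (B : 'M[k]_n) N :
  similar_mx A B -> A ^+ N = 0 -> B ^+ N = 0.
Proof.
case=> f [g [gf fg fA]] AN0.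
suff fX i : f *m A ^+ i = B ^+ i *m f.
  by rewrite -[B ^+ N]mulmx1 -fg mulmxA -fX AN0 mulmx0 mul0mx.
elim: i => [|i IHi]; first by rewrite !expr0 mulmx1 mul1mx.
by rewrite !exprSr mulmxA IHi -!mulmxA fA.
Qed.

Lemma block_diag_mxX m n (A : 'M[k]_m) (B : 'M[k]_n) N :
  (block_mx A 0 0 B) ^+ N = block_mx (A ^+ N) 0 0 (B ^+ N).
Proof.
elim: N => [|N IHN]; first by rewrite !expr0 -scalar_mx_block.
rewrite !exprS IHN -mulmxE mulmx_block.
by rewrite !(mulmx0, mul0mx, addr0, add0r).
Qed.

(* The complementary summand is the image of the idempotent [1 - C B]. *)
Lemma split_similar_mx r n (J : 'M[k]_r) (A : 'M[k]_n)
    (B : 'M_(r, n)) (C : 'M_(n, r)) :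
    B *m C = 1%:M -> B *m A = J *m B -> A *m C = C *m J ->
  exists m (A' : 'M_m), similar_mx A (block_mx J 0 0 A').
Proof.
move=> BC BA AC; pose E := 1%:M - C *m B.
have EC : E *m C = 0 by rewrite mulmxBl mul1mx -mulmxA BC mulmx1 subrr.
have BE : B *m E = 0 by rewrite mulmxBr mulmx1 mulmxA BC mul1mx subrr.
have EE : E *m E = E by rewrite {1}/E mulmxBl mul1mx -mulmxA BE mulmx0 subr0.
(* A full-rank factorization [E = S *m P]. Idempotency of [E] gives [P *m S = 1%:M], so [S] and [P]
   are the inclusion and the projection of the complement. *)
move: (row_base_free E) (col_base_full E) (mulmx_base E).
move: (row_base E) (col_base E); move: (\rank E) => m P S Pfree Sfull SP.
have Pinj := row_free_injr Pfree; have Sinj p := @row_full_inj _ _ _ p _ Sfull.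
have PS : P *m S = 1%:M.
  apply: Pinj => /=; rewrite mul1mx; apply: Sinj.
  by rewrite mulmxA mulmxA SP -mulmxA SP EE.
have PC : P *m C = 0 by apply: Sinj => /=; rewrite mulmxA SP EC mulmx0.
have BS : B *m S = 0.
  by rewrite -[B *m S]mulmx1 -PS mulmxA -(mulmxA B) SP BE mul0mx.
have AE : A *m E = E *m A.
  by rewrite mulmxBr mulmxBl mulmx1 mul1mx mulmxA AC -!mulmxA BA.
exists m, (P *m A *m S); exists (col_mx B P), (row_mx C S); split.
- by rewrite mul_row_col SP addrC subrK.
- by rewrite mul_col_row BC BS PC PS -scalar_mx_block.
rewrite mul_col_mx mul_block_col !mul0mx addr0 add0r BA; congr col_mx.
by rewrite -!mulmxA SP AE -SP !mulmxA PS mul1mx.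
Qed.

(** * Jordan form of nilpotent matrices *)

Definition jordan_block r : 'M[k]_r := \matrix_(i, j) (i.+1 == j)%:R.

(** Fix a nonzero entry [(i0, j0)] of [A ^+ r]. The rows of [B] form a Jordan chain of row vectors,
    the columns of [C] one of column vectors. The pairing [B *m C] is upper triangular with constant
    diagonal [(A ^+ r) i0 j0], hence invertible, and commutes with the block; multiplying [C] by its
    inverse gives the data for [split_similar_mx]. *)
Lemma split_jordan_block n (A : 'M[k]_n) r : A ^+ r.+1 = 0 -> A ^+ r != 0 ->
  exists m (A' : 'M_m), similar_mx A (block_mx (jordan_block r.+1) 0 0 A').
Proof.
move=> Ar1 /eqP Ar.
have [i0 [j0 Aij]] : exists i j, (A ^+ r) i j != 0.
  apply: contrapT => nA; apply: Ar; apply/matrixP => i j; rewrite mxE.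
  by apply: contrapT => /eqP nz; apply: nA; exists i, j.
have Age s : (r < s)%N -> A ^+ s = 0.
  by move=> rs; rewrite -(subnK rs) exprD Ar1 mulr0.
pose J := jordan_block r.+1.
pose B : 'M_(r.+1, n) := \matrix_(i, l) (A ^+ i) i0 l.
pose C : 'M_(n, r.+1) := \matrix_(l, j) (A ^+ (r - j)) l j0.
have BC i j : (B *m C) i j = (A ^+ (i + (r - j))) i0 j0.
  by rewrite exprD -mulmxE !mxE; apply: eq_bigr => l _; rewrite !mxE.
have BA : B *m A = J *m B.
  apply/matrixP => i l; transitivity ((A ^+ i.+1) i0 l).
    by rewrite exprSr -mulmxE !mxE; apply: eq_bigr => u _; rewrite !mxE.
  rewrite mxE; have [ir|ri] := ltnP i r.
    rewrite (bigD1 (Ordinal (ir : i.+1 < r.+1)%N)) //= !mxE eqxx mul1r.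
    rewrite big1 ?addr0 // => u; rewrite -val_eqE /= => /negPf nu.
    by rewrite !mxE eq_sym nu mul0r.
  rewrite Age // mxE big1 // => u _; rewrite !mxE.
  by rewrite gtn_eqF ?mul0r // (leq_trans (ltn_ord u)).
have AC : A *m C = C *m J.
  apply/matrixP => l j; transitivity ((A ^+ (r - j).+1) l j0).
    by rewrite exprS -mulmxE !mxE; apply: eq_bigr => u _; rewrite !mxE.
  rewrite mxE; case: j => [[|j] jr] /=.
    by rewrite subn0 Ar1 mxE big1 // => u _; rewrite !mxE mulr0.
  rewrite (bigD1 (Ordinal (ltnW jr))) //= !mxE eqxx mulr1 big1 ?addr0.
    by rewrite subnSK.
  by move=> u; rewrite -val_eqE /= => /negPf nu; rewrite !mxE eqSS nu mulr0.
pose T := B *m C.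
have uT : T \in unitmx.
  rewrite unitmxE -det_tr det_trig; last first.
    apply/is_trig_mxP => i j ij; rewrite mxE BC Age ?mxE //.
    by have := ltn_ord i; lia.
  rewrite unitfE; apply/prodf_neq0 => i _; rewrite mxE BC subnKC //.
  exact: leq_ord.
have TJ : T *m J = J *m T by rewrite /T -mulmxA -AC !mulmxA BA.
have TJ' : invmx T *m J = J *m invmx T.
  by apply: (can_inj (mulKmx uT)); rewrite mulKVmx // !mulmxA TJ mulmxK.
apply: (@split_similar_mx _ _ J A B (C *m invmx T)) => //.
- by rewrite mulmxA mulmxV.
- by rewrite mulmxA AC -!mulmxA TJ'.
Qed.

Fixpoint jordan_mx (s : seq nat) : 'M[k]_(sumn s) :=
  if s is r :: s' then block_mx (jordan_block r) 0 0 (jordan_mx s') else 0.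

Lemma nilpotency_index n (A : 'M[k]_n) N : (0 < n)%N -> A ^+ N = 0 ->
  exists r, [/\ (r < N)%N, A ^+ r.+1 = 0 & A ^+ r != 0].
Proof.
move=> n0; elim: N => [|N IHN] AN.
  case: n n0 A AN => // n _ A /matrixP/(_ ord0 ord0)/eqP.
  by rewrite expr0 !mxE oner_eq0.
have [/IHN[r [rN Ar1 Ar]]|nz] := eqVneq (A ^+ N) 0; last by exists N.
by exists r; split=> //; apply: ltnW.
Qed.

(** Splitting off a block of the size of the nilpotency index leaves a smaller nilpotent matrix.
    Positivity of the block sizes later bounds their number. *)
Lemma jordan_form n (A : 'M[k]_n) N : A ^+ N = 0 ->
  exists2 s, all (fun r => 0 < r)%N s & similar_mx A (jordan_mx s).
Proof.
elim/ltn_ind: n A => -[_ A _|n IHn A AN].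
  by exists [::] => //; rewrite (flatmx0 A); apply: similar_mx_refl.
have [//|r [rN Ar1 Ar]] := nilpotency_index _ AN.
have [m [A' AA']] := split_jordan_block Ar1 Ar.
have mn : (m < n.+1)%N by rewrite (similar_mx_size AA') addSn ltnS leq_addl.
have A'N : A' ^+ N = 0.
  have := similar_mxX AA' AN; rewrite block_diag_mxX -(block_mx0 k).
  by case/eq_block_mx.
have [s s0 A's] := IHn m mn A' A'N.
exists (r.+1 :: s) => //.
exact: similar_mx_trans AA' (similar_block_mx _ A's).
Qed.

End Conjugacy.

(** * The Zariski topology of the representation spaces *)

Section Evaluation.
Variables (k : fieldType) (Q : quiver).

Lemma eval_repE (d : vertex Q -> nat) (M : rep_space k d) f x y :
  eval_rep M f x y = fglift (fun p => path_mx M p x y) f.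
Proof. by rewrite fglift_sum. Qed.

Lemma path_mx_walk (d : vertex Q -> nat) (M : rep_space k d) x y
  (p : walk x y) : path_mx M (Path p) x y = walk_mx M p.
Proof.
rewrite /path_mx /=; case: eqP => // ex; case: eqP => // ey.
by rewrite !eq_axiomK castmx_id.
Qed.

(** Equivariance passes from arrows to walks by induction, then to linear combinations. Since [f]
    need not be invertible, this covers inclusions of summands. *)
Lemma eval_rep_intertwine (d e : vertex Q -> nat) (M : rep_space k d)
    (N : rep_space k e) (f : forall x, 'M[k]_(e x, d x)) :
    (forall a, f (hd a) *m M a = N a *m f (tl a)) ->
  forall u x y, f y *m eval_rep M u x y = eval_rep N u x y *m f x.
Proof.
move=> fMN u x y; rewrite /eval_rep mulmx_sumr mulmx_suml.
apply: eq_bigr => p _; rewrite -scalemxAl -scalemxAr; congr (_ *: _).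
have [/andP[/eqP ex /eqP ey]|] := boolP ((src p == x) && (tgt p == y)).
  case: p ex ey => x' y' p /= ex ey; subst x' y'; rewrite !path_mx_walk.
  elim: p => {y} [z|z a p IHp] /=; first by rewrite mulmx1 mul1mx.
  by rewrite mulmxA fMN -!mulmxA IHp.
rewrite /path_mx; case: (src p =P x) => [ex|?]; last by rewrite mulmx0 mul0mx.
by case: (tgt p =P y) => [ey|?] => [|_]; rewrite ?mulmx0 ?mul0mx //= .
Qed.

Variable I : ideal (path_algebra k Q).

(** The injection [f] carries an evaluation on [V] to one on [W], which vanishes; the left inverse
    [g] then cancels [f]. Only [f] has to commute with the arrows. *)
Lemma is_module_summand (V W : rep k Q)
    (f : forall x, 'M[k]_(dimv W x, dimv V x))
    (g : forall x, 'M[k]_(dimv V x, dimv W x)) :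
    (forall x, g x *m f x = 1%:M) ->
    (forall a, f (hd a) *m rep_mx V a = rep_mx W a *m f (tl a)) ->
  is_module I W -> is_module I V.
Proof.
move=> gf fVW modW u Iu x y.
have := eval_rep_intertwine fVW u x y; rewrite modW // mul0mx.
move/(congr1 (mulmx (g y))).
by rewrite mulmxA gf mul1mx mulmx0.
Qed.

Lemma rep_iso_module (V W : rep k Q) :
  rep_iso V W -> is_module I V -> is_module I W.
Proof.
move=> [f [g [gf fg fVW]]]; apply: (@is_module_summand _ _ g f) => // a.
rewrite -[_ *m rep_mx W a]mulmx1 -fg mulmxA -(mulmxA (g _)) -fVW.
by rewrite mulmxA gf mul1mx.
Qed.

Lemma is_module_direct_suml (V W : rep k Q) :
  is_module I (direct_sum V W) -> is_module I V.
Proof.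
apply: (@is_module_summand V (direct_sum V W) (fun _ => col_mx 1%:M 0)
                               (fun _ => row_mx 1%:M 0)) => [x|a] /=.
  by rewrite mul_row_col mulmx0 addr0 mulmx1.
by rewrite mul_col_mx mul_block_col !(mul1mx, mulmx1, mul0mx, mulmx0, addr0).
Qed.

Lemma is_module_direct_sumr (V W : rep k Q) :
  is_module I (direct_sum V W) -> is_module I W.
Proof.
apply: (@is_module_summand W (direct_sum V W) (fun _ => col_mx 0 1%:M)
                               (fun _ => row_mx 0 1%:M)) => [x|a] /=.
  by rewrite mul_row_col mulmx0 add0r mulmx1.
by rewrite mul_col_mx mul_block_col !(mul1mx, mulmx1, mul0mx, mulmx0, add0r).
Qed.

Lemma GL_orbit_rep_iso (d : vertex Q -> nat) (M N : rep_space k d) :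
  GL_orbit M N -> rep_iso (Rep M) (Rep N).
Proof.
move=> [g [gU Ng]]; exists g, (fun x => invmx (g x)); split=> [x|x|a] /=.
- by rewrite mulVmx.
- by rewrite mulmxV.
- by rewrite Ng mulmxKV.
Qed.

Lemma rep_iso_GL_orbit (d : vertex Q -> nat) (M N : rep_space k d) :
  rep_iso (Rep M) (Rep N) -> GL_orbit M N.
Proof.
move=> [f [g [gf fg fMN]]]; have fU x : f x \in unitmx.
  by case: (mulmx1_unit (fg x)).
by exists f; split=> // a; rewrite fMN mulmxK.
Qed.

End Evaluation.

(** * Closed sets, closures and irreducible sets *)

Section Zariski.
Variables (k : fieldType) (Q : quiver) (d : vertex Q -> nat).
Local Notation R := (rep_space k d).
Implicit Types (F G Z : set R) (M N : R).

(** Lets closed conditions be built up from matrix entries without writing out multivariate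
    polynomials. *)
Definition polynomial_fun (F : R -> k) : Prop :=
  exists p : {mpoly k[#|coordinate d|]}, forall M, F M = p.@[coordinates M].

Lemma polynomial_fun_cst c : polynomial_fun (fun=> c).
Proof. by exists c%:MP => M; rewrite mevalC. Qed.

Lemma polynomial_fun_entry a i j : polynomial_fun (fun M => M a i j).
Proof.
exists 'X_(enum_rank
  (Tagged (fun a => 'I_(d (hd a)) * 'I_(d (tl a)))%type (i, j))).
by move=> M; rewrite mevalXU /coordinates enum_rankK.
Qed.

Lemma polynomial_funD (F G : R -> k) : polynomial_fun F -> polynomial_fun G ->
  polynomial_fun (fun M => F M + G M).
Proof. by case=> p Fp [q Gq]; exists (p + q) => M; rewrite mevalD Fp Gq. Qed.

Lemma polynomial_funM (F G : R -> k) : polynomial_fun F -> polynomial_fun G ->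
  polynomial_fun (fun M => F M * G M).
Proof. by case=> p Fp [q Gq]; exists (p * q) => M; rewrite mevalM Fp Gq. Qed.

Lemma polynomial_fun_sum T (s : seq T) (F : T -> R -> k) :
    (forall t, polynomial_fun (F t)) ->
  polynomial_fun (fun M => \sum_(t <- s) F t M).
Proof.
move=> Fpoly; elim: s => [|t s IHs].
  by have [p pE] := polynomial_fun_cst 0; exists p => M; rewrite big_nil.
have [p pE] := polynomial_funD (Fpoly t) IHs.
by exists p => M; rewrite big_cons.
Qed.

Lemma zariski_closed_zeros (P : set (R -> k)) :
    (forall h, P h -> polynomial_fun h) ->
  zariski_closed [set M | forall h, P h -> h M = 0].
Proof.
move=> Ppoly.
exists [set p | exists2 h, P h & forall M, h M = p.@[coordinates M]].
apply/seteqP; split=> M /= ZM; first by move=> p [h Ph hp]; rewrite -hp ZM.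
by move=> h Ph; have [p hp] := Ppoly h Ph; rewrite hp; apply: ZM; exists h.
Qed.

(** By induction on the walk, each entry of its matrix is polynomial in the entries of the arrow
    matrices; a relation combines finitely many of these linearly. *)
Lemma rep_variety_closed (I : ideal (path_algebra k Q)) :
  zariski_closed (rep_variety I (d := d)).
Proof.
pose P : set (R -> k) := [set h | exists u x y i j,
  ideal_set I u /\ h = fun M => eval_rep M u x y i j].
have -> : rep_variety I (d := d) = [set M | forall h, P h -> h M = 0].
  apply/seteqP; split=> M /= XM.
    by move=> _ [u [x [y [i [j [Iu ->]]]]]]; rewrite XM // mxE.
  move=> u Iu x y; apply/matrixP => i j; rewrite mxE.
  by apply: (XM (fun M => eval_rep M u x y i j)); exists u, x, y, i, j.
apply: zariski_closed_zeros => _ [u [x [y [i [j [_ ->]]]]]].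
suff path_poly p : polynomial_fun (fun M => path_mx M p x y i j).
  have [q qE] := polynomial_fun_sum (dom u)
    (fun p => polynomial_funM (polynomial_fun_cst (coeff p u)) (path_poly p)).
  exists q => M; rewrite -qE /eval_rep summxE.
  by apply: eq_bigr => p _; rewrite mxE.
have [/andP[/eqP ex /eqP ey]|npxy] :=
  boolP ((src p == x) && (tgt p == y)); last first.
  have [q qE] := polynomial_fun_cst 0; exists q => M; rewrite -(qE M).
  move: npxy; rewrite /path_mx.
  case: (src p =P x) => [ex|?]; last by rewrite mxE.
  by case: (tgt p =P y) => [ey|?]; rewrite //= mxE.
case: p ex ey => x' y' p /= ex ey; subst x' y'.
suff [q qE] : polynomial_fun (fun M => walk_mx M p i j).
  by exists q => M; rewrite path_mx_walk.
elim: p j i => {y} [z|z a p IHp] /= j i.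
  by have [q qE] := polynomial_fun_cst ((1%:M : 'M[k]_(d z)) i j); exists q.
have [q qE] := polynomial_fun_sum (index_enum 'I_(d (tl a)))
  (fun l => polynomial_funM (polynomial_fun_entry i l) (IHp j l)).
by exists q => M; rewrite -qE mxE.
Qed.

Lemma zariski_closed0 : zariski_closed (set0 : set R).
Proof.
exists [set 1]; apply/seteqP; split=> // M /= /(_ _ erefl).
by rewrite meval1 => /eqP; rewrite oner_eq0.
Qed.

Lemma zariski_closedU F G :
  zariski_closed F -> zariski_closed G -> zariski_closed (F `|` G).
Proof.
move=> [S ->] [T ->].
exists [set r | exists p q, [/\ S p, T q & r = p * q]].
apply/seteqP; split=> M /=.
  move=> [ZM|ZM] _ [p [q [Sp Tq ->]]]; rewrite mevalM.
    by rewrite ZM ?mul0r.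
  by rewrite [q.@[_]]ZM ?mulr0.
move=> ZM; apply: contrapT => /not_orP[/existsNP[p /not_implyP[Sp /eqP p0]]].
move=> /existsNP[q /not_implyP[Tq /eqP q0]].
have /eqP : (p * q).@[coordinates M] = 0 by apply: ZM; exists p, q.
by rewrite mevalM mulf_eq0 (negPf p0) (negPf q0).
Qed.

Definition zariski_closure Z : set R :=
  [set M | forall F, zariski_closed F -> Z `<=` F -> F M].

Lemma zariski_closure_closed Z : zariski_closed (zariski_closure Z).
Proof.
exists [set p | forall M, Z M -> p.@[coordinates M] = 0].
apply/seteqP; split=> M /= ZM.
  move=> p Zp; apply: (ZM [set N | p.@[coordinates N] = 0]) => //.
  exists [set p]; apply/seteqP; split=> N /= pN; last exact: pN.
  by move=> _ ->.
move=> F [S ->] ZF /= p Sp; apply: ZM => N ZN.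
exact: ZF ZN p Sp.
Qed.

Lemma subset_zariski_closure Z : Z `<=` zariski_closure Z.
Proof. by move=> M ZM F _; apply. Qed.

Lemma zariski_closure_sub F Z :
  zariski_closed F -> Z `<=` F -> zariski_closure Z `<=` F.
Proof. by move=> cF ZF M; apply. Qed.

Lemma irreducible_closure Z :
  irreducible_set Z -> irreducible_set (zariski_closure Z).
Proof.
move=> [[M ZM] irrZ]; split.
  by exists M; apply: subset_zariski_closure.
move=> F G cF cG /(subset_trans (@subset_zariski_closure Z)).
by case/(irrZ F G cF cG) => H; [left|right]; apply: zariski_closure_sub.
Qed.

(** Irreducibility handles two closed sets at a time, so the list is peeled from its head; a point
    of [Z] rules out the empty union. *)
Lemma irreducible_finite_union (T : eqType) (s : seq T) (F : T -> set R) Z :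
    irreducible_set Z -> (forall t, zariski_closed (F t)) ->
    (forall M, Z M -> exists2 t, t \in s & F t M) ->
  exists2 t, t \in s & Z `<=` F t.
Proof.
move=> [Z0 irrZ] cF ZF.
pose U (s : seq T) := [set M | exists2 t, t \in s & F t M].
have U_cons t s' : U (t :: s') = F t `|` U s'.
  apply/seteqP; split=> M /=.
    case=> u; rewrite inE => /orP[/eqP->|us] FuM; first by left.
    by right; exists u.
  by case=> [FM|[u us FM]]; [exists t|exists u]; rewrite ?inE ?eqxx ?us ?orbT.
have cU s' : zariski_closed (U s').
  elim: s' => [|t s' IHs]; last by rewrite U_cons; apply: zariski_closedU.
  suff -> : U [::] = set0 by apply: zariski_closed0.
  by apply/seteqP; split=> // M [].
have {ZF} : Z `<=` U s by [].
elim: s => [|t s IHs] ZU; first by case: Z0 => M /ZU[].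
rewrite U_cons in ZU; have [ZFt|/IHs[u us ZFu]] := irrZ _ _ (cF t) (cU s) ZU.
  by exists t; rewrite ?mem_head.
by exists u; rewrite // inE us orbT.
Qed.

End Zariski.

(** * Irreducibility and dense orbits over an algebraically closed field *)

Section Irreducibility.
Variable k : closedFieldType.

(** The polynomial [p + 1] has no root, so it is constant over a closed field. *)
Lemma poly_zero_function (p : {poly k}) : (forall t, p.[t] = 0) -> p = 0.
Proof.
move=> p0; have [/size_poly1P[c _ pc]|] := boolP (size (p + 1) == 1).
  have pE : p = (c - 1)%:P by rewrite polyCB -pc addrK.
  by have := p0 0; rewrite pE hornerC => ->.
by case/closed_rootP => t; rewrite rootE !hornerE p0 add0r oner_eq0.
Qed.

(** A left inverse [g] of [f] would enumerate the field, and the monic polynomial with roots [g t]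
    would vanish everywhere. *)
Lemma no_injection_to_fintype (T : finType) (f : k -> T) : ~ injective f.
Proof.
move=> f_inj; have [g fK] : exists g, cancel f g.
  have inv t : exists x, forall y, f y = t -> x = y.
    have [[x <-]|nx] := pselect (exists x, f x = t).
      by exists x => y /f_inj.
    by exists 0 => y fy; case: nx; exists y.
  by exists (fun t => sval (cid (inv t))) => x; apply: (svalP (cid (inv _))).
pose p := \prod_t ('X - (g t)%:P).
suff p0 : p = 0.
  have : p != 0 by apply/monic_neq0/monic_prod_XsubC.
  by rewrite p0 eqxx.
apply: poly_zero_function => x; rewrite horner_prod (bigD1 (f x)) //=.
by rewrite fK !hornerE subrr mul0r.
Qed.

Variable Q : quiver.

(** Clearing denominators: [P] is [D ^+ msize p] times the value of [p] at the fractions [h i / D].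
    Every monomial has degree below [msize p], so the exponents of [D] stay nonnegative. *)
Lemma meval_rational_curve n (p : {mpoly k[n]}) (h : 'I_n -> {poly k})
    (D : {poly k}) : exists P : {poly k}, forall t, D.[t] != 0 ->
  (P.[t] == 0) = (p.@[fun i => (h i).[t] / D.[t]] == 0).
Proof.
exists (\sum_(m <- msupp p)
  (p@_m)%:P * D ^+ (msize p - mdeg m) * \prod_i h i ^+ m i) => t Dt.
rewrite -[in RHS](inj_eq (mulfI (expf_neq0 (msize p) Dt)) _ 0) mulr0.
congr (_ == 0); rewrite horner_sum mevalE mulr_sumr !big_seq.
apply: eq_bigr => m pm; rewrite !hornerM hornerC horner_exp horner_prod.
have -> : \prod_i ((h i).[t] / D.[t]) ^+ m i =
    (\prod_i (h i).[t] ^+ m i) / D.[t] ^+ mdeg m.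
  rewrite mdegE -prodrXr -prodf_div.
  by apply: eq_bigr => i _; rewrite expr_div_n.
rewrite -[X in _ = D.[t] ^+ X * _](subnK (ltnW (msize_mdeg_lt pm))) exprD.
under eq_bigr do rewrite horner_exp.
move: (expf_neq0 (mdeg m) Dt) (\prod_i _ ^+ _) => Dm0 y.
rewrite -!mulrA mulrCA; congr (_ * _); rewrite mulrCA; congr (_ * _).
by rewrite mulrCA mulfV ?mulr1.
Qed.

(* Two closed sets covering [Z] restrict to the curve through a point outside
   each, where the product of two nonzero polynomials would vanish. *)
Lemma irreducible_of_curves (d : vertex Q -> nat) (Z : set (rep_space k d)) :
    Z !=set0 ->
    (forall M N, Z M -> Z N ->
      exists (c : k -> rep_space k d) (D : {poly k}) h t0 t1,
      [/\ c t0 = M, c t1 = N, D.[t0] != 0, D.[t1] != 0 & forall t, D.[t] != 0 ->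
        Z (c t) /\ coordinates (c t) =1 fun i => (h i).[t] / D.[t]]) ->
  irreducible_set Z.
Proof.
move=> Z0 curves; split=> // F G [S ->] [T ->] ZFG.
apply: contrapT => /not_orP[].
move=> /existsNP[M /not_implyP[ZM /existsNP[p /not_implyP[Sp /eqP pM]]]].
move=> /existsNP[N /not_implyP[ZN /existsNP[q /not_implyP[Tq /eqP qN]]]].
have [c [D [h [t0 [t1 [c0 c1 D0 D1 cZ]]]]]] := curves M N ZM ZN.
have [P PE] := meval_rational_curve p h D.
have [R RE] := meval_rational_curve q h D.
have evalE r t : D.[t] != 0 ->
    r.@[fun i => (h i).[t] / D.[t]] = r.@[coordinates (c t)].
  by move=> Dt; apply: meval_eq => i; rewrite (cZ t Dt).2.
(* The factor [D] takes care of the parameters where the curve is undefined. *)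
suff /eqP : P * R * D = 0.
  rewrite !mulf_eq0 => /orP[/orP[|]|] /eqP E.
  - by move: pM; rewrite -c0 -evalE // -PE // E horner0 eqxx.
  - by move: qN; rewrite -c1 -evalE // -RE // E horner0 eqxx.
  - by move: D0; rewrite E horner0 eqxx.
apply: poly_zero_function => t; rewrite !hornerM.
have [->|Dt] := eqVneq D.[t] 0; first by rewrite mulr0.
apply/eqP; rewrite !mulf_eq0 PE // RE // !evalE //.
case: (ZFG (c t) (cZ t Dt).1) => [/(_ p Sp) ->|/(_ q Tq) ->].
  by rewrite eqxx.
by rewrite eqxx orbT.
Qed.

(** Two points of the orbit, given by [g] and [g'], are joined by letting the line from [g] to [g']
    act on [M]. The inverses are adjugates over determinants, so the curve is rational, defined
    where all determinants are nonzero. *)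
Lemma GL_orbit_irreducible (d : vertex Q -> nat) (M : rep_space k d) :
  irreducible_set (GL_orbit M).
Proof.
apply: irreducible_of_curves.
  exists M; exists (fun x => 1%:M); split=> [x|a]; first exact: unitmx1.
  by rewrite mul1mx invmx1 mulmx1.
pose act (g : forall x, 'M[k]_(d x)) : rep_space k d :=
  fun a => g (hd a) *m M a *m invmx (g (tl a)).
move=> N N' [g [gU NE]] [g' [gU' NE']].
have {NE}-> : N = act g by apply: functional_extensionality_dep.
have {NE'}-> : N' = act g' by apply: functional_extensionality_dep.
pose G x : 'M[{poly k}]_(d x) :=
  map_mx polyC (g x) + 'X *: map_mx polyC (g' x - g x).
pose Gt t x := map_mx (horner_eval t) (G x).
have GtE t x : Gt t x = g x + t *: (g' x - g x).
  by apply/matrixP => i j; rewrite !mxE /horner_eval !hornerE.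
have detG t x : (\det (G x)).[t] = \det (Gt t x).
  by rewrite -[LHS]/(horner_eval t _) -det_map_mx.
pose D := \prod_x \det (G x).
have DtP t : reflect (forall x, Gt t x \in unitmx) (D.[t] != 0).
  rewrite horner_prod; apply: (iffP idP) => [/prodf_neq0 H x|H].
    by rewrite unitmxE unitfE -detG H.
  by apply/prodf_neq0 => x _; rewrite detG -unitfE -unitmxE.
exists (fun t => act (Gt t)), D.
(* The inverse at [tl a] has only the determinant there as denominator; the other determinants
   extend the fraction to the common denominator [D]. *)
pose E (a : arrow Q) := (\prod_(x | x != tl a) \det (G x)) *:
  (G (hd a) *m map_mx polyC (M a) *m \adj (G (tl a))).
exists (fun i => let c := enum_val i in
  E (tag c) (tagged c).1 (tagged c).2), 0, 1.
have Gt0 x : Gt 0 x = g x by rewrite GtE scale0r addr0.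
have Gt1 x : Gt 1 x = g' x by rewrite GtE scale1r addrC subrK.
split.
- by congr act; apply: functional_extensionality_dep => x; rewrite Gt0.
- by congr act; apply: functional_extensionality_dep => x; rewrite Gt1.
- by apply/DtP => x; rewrite Gt0.
- by apply/DtP => x; rewrite Gt1.
move=> t Dt; move/DtP: (Dt) => U.
split; first by exists (Gt t).
move=> i; rewrite /coordinates; case: (enum_val i) => a [u v] /=.
have detU : \det (Gt t (tl a)) != 0 by rewrite -unitfE -unitmxE.
have DE : D.[t] = \det (Gt t (tl a)) * (\prod_(x | x != tl a) \det (G x)).[t].
  by rewrite /D (bigD1 (tl a)) //= hornerM detG.
move: Dt; rewrite DE mulf_eq0 negb_or => /andP[_ Dt].
rewrite /E [X in _ = X.[_] / _]mxE hornerM /act /invmx U -scalemxAr [LHS]mxE.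
set W := G (hd a) *m _ *m _.
have -> : (W u v).[t] = map_mx (horner_eval t) W u v by rewrite [RHS]mxE.
rewrite /W !map_mxM map_mx_adj -map_mx_comp -/(Gt t (hd a)) -/(Gt t (tl a)).
have -> : map_mx (horner_eval t \o polyC) (M a) = M a.
  by apply/matrixP => x y; rewrite mxE /= /horner_eval hornerC.
move: (_ u v) => w; move: (_.[t]) Dt (\det _) detU => c c0 D0 D00.
by rewrite invfM [c * w]mulrC -mulrA [c * _]mulrC mulfVK // mulrC.
Qed.

(** A component is covered by the closures of finitely many label classes, hence lies in one of
    them, and so in an orbit closure. That closure is irreducible and inside the variety, so
    maximality gives equality. As [lab] is a relation, a module may carry several labels. *)
Lemma finite_orbits_dense (I : ideal (path_algebra k Q)) (d : vertex Q -> nat)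
    (T : eqType) (s : seq T) (lab : rep_space k d -> T -> Prop) :
    (forall M, rep_variety I M -> exists2 t, t \in s & lab M t) ->
    (forall t M N, rep_variety I M -> rep_variety I N ->
      lab M t -> lab N t -> GL_orbit M N) ->
  forall Z, irreducible_component (rep_variety I (d := d)) Z ->
    has_dense_orbit Z.
Proof.
move=> labX lab_orbit Z [ZX irrZ maxZ].
pose X : set (rep_space k d) := rep_variety I (d := d).
pose O t := [set M | X M /\ lab M t].
have [M ZM|t ts ZO] := @irreducible_finite_union _ _ _ _ s
  (fun t => zariski_closure (O t)) Z irrZ (fun t => zariski_closure_closed _).
  have [t ts Mt] := labX M (ZX M ZM); exists t => //.
  by apply: subset_zariski_closure; split; first exact: ZX.
(* An empty class has empty closure, which cannot contain the nonempty [Z]. *)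
have [M [XM Mt]] : O t !=set0.
  apply: contrapT => O0; case: irrZ => -[M /ZO ZM] _.
  case: (ZM set0 (@zariski_closed0 _ _ _)) => N ON.
  by apply: O0; exists N.
have orbX : GL_orbit M `<=` X.
  by move=> N /GL_orbit_rep_iso/rep_iso_module/(_ XM).
have Oorb : O t `<=` GL_orbit M by move=> N [XN Nt]; apply: lab_orbit Mt Nt.
have Zorb : Z `<=` zariski_closure (GL_orbit M).
  apply: subset_trans ZO _; apply: zariski_closure_sub.
    exact: zariski_closure_closed.
  exact: subset_trans Oorb (@subset_zariski_closure _ _ _ _).
have ZE : zariski_closure (GL_orbit M) = Z.
  apply: maxZ => //; first exact/irreducible_closure/GL_orbit_irreducible.
  by apply: zariski_closure_sub => //; apply: rep_variety_closed.
exists M; rewrite -ZE; split.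
- apply: subset_zariski_closure; exists (fun x => 1%:M).
  by split=> [x|a]; rewrite ?unitmx1 // mul1mx invmx1 mulmx1.
- exact: subset_zariski_closure.
- by move=> F cF orbF; apply: zariski_closure_sub cF orbF.
Qed.

End Irreducibility.

(** * The quiver of a local algebra has one vertex *)

Section LocalAlgebra.
Variables (k : fieldType) (Q : quiver) (I : ideal (path_algebra k Q)).
Hypothesis I_admissible : admissible I.

Local Notation kQ := (path_algebra k Q).
Local Notation A := (quotient_algebra I).
Local Notation e x := (Path (nil_walk x)).

(** The trivial path at [x] factors into two paths only as its own square. *)
Lemma coeff_vertexM x (f g : kQ) :
  coeff (e x) (f * g) = coeff (e x) f * coeff (e x) g.
Proof.
elim/path_algebra_ind: f => [c f f' IHf IHf'| |p].
- by rewrite mulrDl -pa_scalerAl !(coeffD, coeffZ) IHf IHf' mulrDl mulrA.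
- by rewrite mul0r coeff0 mul0r.
elim/path_algebra_ind: g => [c g g' IHg IHg'| |q].
- by rewrite mulrDr -pa_scalerAr !(coeffD, coeffZ) IHg IHg' mulrDr mulrCA.
- by rewrite mulr0 coeff0 mulr0.
rewrite -[of_path k p * _]/(pa_mul _ _) pa_mul_of_path /of_path !coeffU !mul1r.
rewrite /mul_path.
have [E|nE] := eqVneq (tgt q) (src p); last first.
  rewrite path_cat_None //= coeff0 -natrM mulnb.
  case: andP => // -[/eqP pe /eqP qe].
  by move: nE; rewrite pe qe eqxx.
case: p q E => y z p [x' y' q] /= E; subst y'; rewrite path_catE /=.
rewrite /of_path coeffU mul1r -natrM mulnb; congr (_%:R); congr nat_of_bool.
apply/idP/idP => [/eqP E|/andP[/eqP E1 /eqP E2]].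
  have := congr1 (@path_length Q) E; rewrite /path_length /=.
  case: p q E => [y'|y' a p] q //=; case: q => // z' E _.
  by rewrite E eqxx.
have E3 := congr1 (@src Q) E1; rewrite /= in E3; subst y.
have := congr1 (@path_length Q) E1; have := congr1 (@path_length Q) E2.
rewrite /path_length /=.
by case: p q E1 E2 => [y'|y' a p] q //=; case: q => // z' -> _.
Qed.

Lemma coeff_vertex_ideal x f : ideal_set I f -> coeff (e x) f = 0.
Proof.
move=> If; case: I_admissible => N [_ _ /(_ f If) f2].
by apply: coeff_outdom; apply/negP => /f2.
Qed.

(** The character by which [A] acts on the simple module at [x]. The choice of representative is
    immaterial, since elements of [I] have no trivial path in their support. *)
Definition vertex_char x (u : A) : k := coeff (e x) (qrepr u).

Lemma vertex_char_proj x f : vertex_char x (qproj I f) = coeff (e x) f.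
Proof.
apply/eqP; rewrite -subr_eq0 -coeffB; apply/eqP/coeff_vertex_ideal/qprojP.
by rewrite qreprK.
Qed.

Lemma vertex_charB x u v :
  vertex_char x (u - v) = vertex_char x u - vertex_char x v.
Proof.
apply/eqP; rewrite eq_sym subr_eq; apply/eqP.
rewrite -{1}(subrK v u) -[u - v]qreprK -[v in X in vertex_char x X]qreprK.
by rewrite -qprojD !vertex_char_proj coeffD !qreprK.
Qed.

Lemma vertex_charM x u v :
  vertex_char x (u * v) = vertex_char x u * vertex_char x v.
Proof. by rewrite -[u * v]/(qproj I _) vertex_char_proj coeff_vertexM. Qed.

Lemma vertex_char_cst x c : vertex_char x (qproj I (c *: (1 : kQ))) = c.
Proof.
rewrite vertex_char_proj coeffZ -[1]/(pa_one k Q) /pa_one.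
rewrite (bigD1 x) //= coeffD /of_path coeffU eqxx mulr1.
suff -> : coeff (e x) (\sum_(y | y != x) of_path k (e y)) = 0.
  by rewrite addr0 mulr1.
elim/big_rec: _ => [|y f nyx IHf]; first exact: coeff0.
rewrite coeffD IHf addr0 coeffU mul1r; case: eqP => // /(congr1 (@src Q)) /= E.
by rewrite E eqxx in nyx.
Qed.

Lemma vertex_char1 x : vertex_char x 1 = 1.
Proof. by rewrite -[RHS](vertex_char_cst x) scale1r. Qed.

(** An element outside the kernel differs from a nonzero scalar [c] by an element of the kernel, so
    a larger right ideal contains a unit. *)
Lemma vertex_ideal_maximal x :
  maximal_right_ideal [set u : A | vertex_char x u = 0].
Proof.
have chi0 : vertex_char x 0 = 0 by rewrite -(subrr 0) vertex_charB subrr.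
split=> /=.
- split=> [|u v /= u0 v0|u v /= u0] /=; first exact: chi0.
    by rewrite vertex_charB u0 v0 subrr.
  by rewrite vertex_charM u0 mul0r.
- by rewrite vertex_char1 => /eqP; rewrite oner_eq0.
move=> J [J0 JB JM] nJ1 sJ; apply/seteqP; split=> // u Ju /=.
apply: contrapT => /eqP cu; apply: nJ1; pose c := vertex_char x u.
have Jc : J (qproj I (c *: (1 : kQ))).
  rewrite -[qproj _ _](subKr u); apply: JB => //; apply: sJ => /=.
  by rewrite vertex_charB vertex_char_cst subrr.
have -> : 1 = qproj I (c *: (1 : kQ)) * qproj I (c^-1 *: (1 : kQ)).
  rewrite -[RHS]qprojM -pa_scalerAl -pa_scalerAr scalerA mulfV // scale1r.
  by rewrite mulr1.
exact: JM.
Qed.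

(** Without vertices the unit of the path algebra is an empty sum, so [1 = 0] would lie in the
    maximal ideal. *)
Lemma local_vertex : local_ring A -> exists x : vertex Q, True.
Proof.
case=> J [[[J0 _ _] nJ1 _] _]; apply: contrapT => nx.
apply: nJ1; rewrite -[1]/(qproj I (pa_one k Q)) /pa_one big1; last first.
  by move=> x _; case: nx; exists x.
have -> // : qproj I 0 = 0.
by apply: (addIr (qproj I 0)); rewrite -qprojD !add0r.
Qed.

(** For distinct vertices, the trivial path at [x] separates the two kernels: it is killed by the
    character at [y] but not by the one at [x]. *)
Lemma local_one_vertex : local_ring A -> forall x y : vertex Q, x = y.
Proof.
case=> J [_ uniqJ] x y.
have := uniqJ _ (vertex_ideal_maximal x).
rewrite (uniqJ _ (vertex_ideal_maximal y)) => /seteqP[].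
move=> /(_ (qproj I (of_path k (e x)))) sub _.
apply/eqP; apply: contrapT => /negP nxy.
have : vertex_char x (qproj I (of_path k (e x))) = 0.
  apply: sub => /=; rewrite vertex_char_proj /of_path coeffU.
  case: eqP => [/(congr1 (@src Q)) /= E|]; last by rewrite mulr0.
  by rewrite E eqxx in nxy.
rewrite vertex_char_proj /of_path coeffU eqxx mulr1 => /eqP.
by rewrite oner_eq0.
Qed.

End LocalAlgebra.

(** * One vertex *)

Lemma rep_iso_sym (k : fieldType) (Q : quiver) (V W : rep k Q) :
  rep_iso V W -> rep_iso W V.
Proof.
move=> [f [g [gf fg fVW]]]; exists g, f; split=> // a.
rewrite -[_ *m rep_mx W a]mulmx1 -fg mulmxA -(mulmxA (g _)) -fVW.
by rewrite mulmxA gf mul1mx.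
Qed.

Lemma rep_iso_trans (k : fieldType) (Q : quiver) (U V W : rep k Q) :
  rep_iso U V -> rep_iso V W -> rep_iso U W.
Proof.
move=> [f [g [gf fg fUV]]] [f' [g' [gf' fg' fVW]]].
exists (fun x => f' x *m f x), (fun x => g x *m g' x); split=> [x|x|a].
- by rewrite mulmxA -(mulmxA (g x)) gf' mulmx1.
- by rewrite mulmxA -(mulmxA (f' x)) fg mulmx1.
- by rewrite -mulmxA fUV !mulmxA fVW.
Qed.

Section OneVertex.
Variables (k : fieldType) (Q : quiver) (I : ideal (path_algebra k Q)).
Variables (N : nat) (x0 : vertex Q).
Hypothesis N_gt0 : (0 < N)%N.
Hypothesis sNI : paths_ge N `<=` ideal_set I.
Hypothesis sI2 : ideal_set I `<=` paths_ge 2.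
Hypothesis one_vertex : forall x y : vertex Q, x = y.

Local Notation rep_const n := (@rep_space k Q (fun=> n)).
Local Notation X n := (@rep_variety k Q I (fun=> n)).

(** Once [d] is a constant function, all arrow matrices have one square type and multiply without
    casts. *)
Lemma dim_const (d : vertex Q -> nat) : d = fun=> d x0.
Proof. by apply/funext => x; rewrite (one_vertex x x0). Qed.

(** With a single vertex, every word in the arrows is composable. *)
Lemma walk_of_word (w : seq (arrow Q)) : exists y (p : walk x0 y),
  walk_length p = size w /\ forall n (M : rep_const n),
    walk_mx M p = foldr (fun a B => M a *m B) 1%:M w.
Proof.
elim: w => [|a w [y [p [pw pM]]]]; first by exists x0, (nil_walk x0).
have ya := one_vertex y (tl a); subst y.
by exists (hd a), (cons_walk a p); split=> [|n M] /=; rewrite ?pw ?pM.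
Qed.

Lemma module_word0 n (M : rep_const n) (w : seq (arrow Q)) :
  X n M -> (N <= size w)%N -> foldr (fun a B => M a *m B) 1%:M w = 0.
Proof.
move=> XM Nw; have [y [p [pw pM]]] := walk_of_word w.
rewrite -pM -path_mx_walk -(fglift_of_path (fun p => path_mx M p x0 y)).
rewrite -eval_repE; apply: XM; apply: sNI => q.
rewrite mem_dom /of_path coeffU mul1r.
case: (Path p =P q) => [<- _|]; last by rewrite eqxx.
by rewrite /path_length /= pw.
Qed.

Lemma module_arrowX n (M : rep_const n) a :
  X n M -> (M a : 'M_n) ^+ N = 0.
Proof.
move=> XM; rewrite -(@module_word0 n M (nseq N a)) ?size_nseq //.
by elim: N => [|N' IH]; rewrite ?expr0 // exprS IH.
Qed.

Lemma module_arrowMX n (M : rep_const n) a b :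
  X n M -> ((M a : 'M_n) *m (M b : 'M_n)) ^+ N = 0.
Proof.
move=> XM; rewrite -(@module_word0 n M (flatten (nseq N [:: a; b]))) //.
  by elim: N => [|N' IH]; rewrite ?expr0 // exprS IH -mulmxE -mulmxA.
by rewrite size_flatten /shape map_nseq sumn_nseq leq_pmull.
Qed.

(** Relations involve only paths of length at least two, and the matrix of such a path begins with a
    product of two arrow matrices. *)
Lemma square_zero_module n (M : rep_const n) :
  (forall a b, (M a : 'M_n) *m (M b : 'M_n) = 0) -> X n M.
Proof.
move=> MM f /sI2 f2 x y; rewrite /eval_rep big_seq big1 // => p /f2.
case: p => x' y' p; rewrite /path_length /= => p2.
have ex := one_vertex x' x; have ey := one_vertex y' y; subst x' y'.
rewrite path_mx_walk; case: p p2 => {x y} [//|x a p] /= p1.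
suff p0 y (p' : walk x y) : (0 < walk_length p')%N ->
    (M a : 'M_n) *m (walk_mx M p' : 'M_n) = 0 by rewrite (p0 _ p) // scaler0.
case: p' => {y} // y b p' _ /=.
by rewrite (mulmxA (M a : 'M_n) (M b : 'M_n)) MM mul0mx.
Qed.

Lemma similar_rep_iso m n (M : rep_const m)
    (M' : rep_const n) (A : 'M_m) (B : 'M_n) :
  (forall a, M a = A) -> (forall a, M' a = B) -> similar_mx A B ->
  rep_iso (Rep M) (Rep M').
Proof.
move=> MA MB [f [g [gf fg fA]]]; exists (fun=> f), (fun=> g).
by split=> // a; rewrite /= MA MB.
Qed.

(** * At most one loop *)

Section OneArrow.
Hypothesis one_arrow : forall a b : arrow Q, a = b.

(* Without arrows, [A] is an arbitrary nilpotent matrix. *)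
Lemma module_nilpotent n (M : rep_const n) : X n M ->
  exists2 A : 'M_n, A ^+ N = 0 & forall a, M a = A.
Proof.
move=> XM; have [[a _]|na] := pselect (exists a : arrow Q, True).
  exists (M a); first exact: module_arrowX.
  by move=> b; rewrite (one_arrow b a).
exists 0; first by rewrite expr0n gtn_eqF.
by move=> a; case: na; exists a.
Qed.

Lemma one_arrow_representation_finite : representation_finite I.
Proof.
(* Since [A ^+ N = 0], the block split off has size [r.+1] with [r < N], so sizes up to [N]
   suffice. *)
exists N.+1, (fun r : 'I_N.+1 =>
  @Rep k Q (fun=> nat_of_ord r) (fun=> jordan_block k r)).
move=> [d M] XM [nzM indM].
have dE := dim_const d; move: (d x0) dE => n dE; subst d.
have [A AN MA] := module_nilpotent XM.
have [n0|n0] := posnP n; first by case: nzM => x /=.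
have [r [rN Ar1 Ar]] := nilpotency_index n0 AN.
have [m [A' AA']] := split_jordan_block Ar1 Ar.
pose V1 := @Rep k Q (fun=> r.+1) (fun=> jordan_block k r.+1).
pose V2 := @Rep k Q (fun=> m) (fun=> A').
have MV : rep_iso (Rep M) (direct_sum V1 V2).
  exact: (@similar_rep_iso _ (r.+1 + m)%N _ _ _ _ MA _ AA').
have modV := rep_iso_module MV XM.
exists (inord r.+1).
have [/(_ x0)//|/(_ x0) /= m0] := indM _ _ (is_module_direct_suml modV)
  (is_module_direct_sumr modV) MV.
subst m; apply: (@similar_rep_iso _ _ _ _ _ _ MA (fun=> erefl)).
rewrite inordK //; apply: similar_mx_trans AA' _.
(* The complement has size 0; these are the identity between the sizes [r.+1 + 0] and [r.+1]. *)
exists (row_mx 1%:M 0), (col_mx 1%:M 0); split.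
- rewrite mul_col_row !mul1mx mul0mx mulmx0 scalar_mx_block; congr block_mx.
  by rewrite [RHS]flatmx0.
- by rewrite mul_row_col mulmx1 mulmx0 addr0.
- by rewrite mul_row_block mul_mx_row !(mul1mx, mul0mx, mulmx0, mulmx1, addr0).
Qed.

End OneArrow.
End OneVertex.

Fixpoint bounded_seqs (m n : nat) : seq (seq nat) :=
  if m is m'.+1 then
    [::] :: [seq r :: s | r <- iota 0 n.+1, s <- bounded_seqs m' n]
  else [:: [::]].

Lemma mem_bounded_seqs m n s :
  (size s <= m)%N -> all (fun r => (r <= n)%N) s -> s \in bounded_seqs m n.
Proof.
elim: m s => [|m IHm] [|r s] //= sm /andP[rn sn].
rewrite in_cons; apply/orP; right.
rewrite -[_ ++ _]/[seq r :: s | r <- iota 0 n.+1, s <- bounded_seqs m n].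
apply/allpairsP; exists (r, s).
by rewrite mem_iota /= ltnS rn; split=> //; apply: IHm.
Qed.

Section ClosedField.
Variables (k : closedFieldType) (Q : quiver) (I : ideal (path_algebra k Q)).
Variables (N : nat) (x0 : vertex Q).
Hypothesis N_gt0 : (0 < N)%N.
Hypothesis sNI : paths_ge N `<=` ideal_set I.
Hypothesis one_vertex : forall x y : vertex Q, x = y.

Local Notation rep_const n := (@rep_space k Q (fun=> n)).
Local Notation X n := (@rep_variety k Q I (fun=> n)).

Lemma one_arrow_discrete :
  (forall a b : arrow Q, a = b) -> discrete_general_rep_type I.
Proof.
move=> one_arrow d.
have dE := dim_const x0 one_vertex d; move: (d x0) dE => n dE; subst d.
pose lab (M : rep_const n) s :=
  exists2 A : 'M_n, forall a, M a = A & similar_mx A (jordan_mx k s).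
(* The labels are Jordan types: positive block sizes of sum [n], hence at most [n] of them, each at
   most [n]. *)
apply: (@finite_orbits_dense _ _ _ _ _ (bounded_seqs n n) lab).
  move=> M /(module_nilpotent x0 N_gt0 sNI one_vertex one_arrow)[A AN MA].
  have [s s_gt0 As] := jordan_form AN.
  exists s; last by exists A.
  rewrite (similar_mx_size As); apply: mem_bounded_seqs.
    elim: s s_gt0 {As} => //= r s IHs /andP[r0 /IHs].
    by rewrite -add1n; apply: leq_add.
  elim: s {s_gt0 As} => //= r s IHs; rewrite leq_addr.
  by apply: sub_all IHs => t /leq_trans; apply; apply: leq_addl.
move=> s M M' _ _ [A MA As] [A' MA' As'].
apply: rep_iso_GL_orbit; apply: similar_rep_iso MA MA' _.
exact: similar_mx_trans As (similar_mx_sym As').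
Qed.

End ClosedField.

(** * Nilpotent 2 x 2 matrices *)

(** A Jordan block as large as the nilpotency index splits off, so the index is at most [n]. *)
Lemma nilpotent_mx_size (k : fieldType) n (A : 'M[k]_n) N :
  A ^+ N = 0 -> A ^+ n = 0.
Proof.
move=> AN; have [n0|n0] := posnP n; first by subst n; rewrite [LHS]flatmx0.
have [r [_ Ar1 Ar]] := nilpotency_index n0 AN.
have [m [A' /similar_mx_size nE]] := split_jordan_block Ar1 Ar.
suff Age j : (r < j)%N -> A ^+ j = 0 by apply: Age; lia.
by move=> rj; rewrite -(subnK rj) exprD Ar1 mulr0.
Qed.

Section Matrix2.
Variable R : comNzRingType.

Lemma mx2P (A B : 'M[R]_2) : A 0 0 = B 0 0 -> A 0 1 = B 0 1 ->
  A 1 0 = B 1 0 -> A 1 1 = B 1 1 -> A = B.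
Proof.
move=> E00 E01 E10 E11; apply/matrixP => i j.
case: i => [[|[|//]] ip]; case: j => [[|[|//]] jp].
- by move: E00; congr (A _ _ = B _ _); apply: val_inj.
- by move: E01; congr (A _ _ = B _ _); apply: val_inj.
- by move: E10; congr (A _ _ = B _ _); apply: val_inj.
- by move: E11; congr (A _ _ = B _ _); apply: val_inj.
Qed.

Lemma mulmx2E (A B : 'M[R]_2) i j :
  (A *m B) i j = A i 0 * B 0 j + A i 1 * B 1 j.
Proof.
by rewrite mxE !big_ord_recl big_ord0 addr0; congr (_ + A _ _ * B _ _);
  apply: val_inj.
Qed.

(* The general nilpotent matrix up to a scalar: image and kernel are spanned
   by [(p, q)]. *)
Definition nilpotent2 (p q : R) : 'M[R]_2 :=
  \matrix_(i, j) ((if i == 0 then p else q) * (if j == 0 then - q else p)).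

Lemma nilpotent2_square p q : nilpotent2 p q *m nilpotent2 p q = 0.
Proof.
apply/matrixP => i j; rewrite mulmx2E !mxE /=.
by case: ifP; case: ifP => _ _; ring.
Qed.

End Matrix2.

Section Nilpotent2Field.
Variable k : fieldType.

(** Trace and determinant vanish. The off-diagonal entries of the square are those of [A] times the
    trace; a nonzero trace would make [A] diagonal, with diagonal entries of square zero. *)
Lemma square_zero_mx2 (A : 'M[k]_2) : A *m A = 0 ->
  A 1 1 = - A 0 0 /\ A 0 0 ^+ 2 + A 0 1 * A 1 0 = 0.
Proof.
move=> AA; have E i j : A i 0 * A 0 j + A i 1 * A 1 j = 0.
  by rewrite -mulmx2E AA mxE.
have E00 := E 0 0; have E01 := E 0 1; have E10 := E 1 0; have E11 := E 1 1.
split; last by rewrite expr2.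
apply/eqP; rewrite -addr_eq0; apply: contrapT => /negP tr0.
have b0 : A 0 1 = 0.
  by apply: (mulfI tr0); rewrite mulr0 -E01; ring.
have c0 : A 1 0 = 0.
  by apply: (mulfI tr0); rewrite mulr0 -E10; ring.
move: E00 E11; rewrite b0 c0 !mul0r addr0 add0r => /eqP + /eqP.
rewrite !mulf_eq0 !orbb => /eqP a0 /eqP d0.
by move: tr0; rewrite a0 d0 addr0 eqxx.
Qed.

(** If [A] and [B] are nonzero, each has equal image and kernel, a line; the trace of the product
    vanishes exactly when the two lines agree. *)
Lemma square_zero_mulmx2 (A B : 'M[k]_2) :
    A *m A = 0 -> B *m B = 0 -> (A *m B) *m (A *m B) = 0 ->
  A *m B = 0.
Proof.
move=> /square_zero_mx2[A11 A00] /square_zero_mx2[B11 B00].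
move=> /square_zero_mx2[trAB _].
set a := A 0 0 in A11 A00; set b := A 0 1 in A00; set c := A 1 0 in A00.
set d := B 0 0 in B11 B00; set e := B 0 1 in B00; set f := B 1 0 in B00.
have tr0 : a * d *+ 2 + b * f + c * e = 0.
  move/eqP: trAB; rewrite -addr_eq0 !mulmx2E A11 B11 -/a -/b -/c -/d -/e -/f.
  by move=> /eqP <-; ring.
(* The square of each entry of [A *m B] is a combination of three vanishing quantities: the trace of
   [A *m B] and, up to sign, the determinants of [A] and [B]. *)
have sqr0 (x u v w : k) : x ^+ 2 = u * (a * d *+ 2 + b * f + c * e)
    + v * (a ^+ 2 + b * c) + w * (d ^+ 2 + e * f) -> x = 0.
  by rewrite tr0 A00 B00 !mulr0 !addr0 => /eqP; rewrite expf_eq0 => /eqP.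
apply: mx2P; rewrite !mulmx2E ?A11 ?B11 !mxE -/a -/b -/c -/d -/e -/f.
- by apply: (sqr0 _ (b * f) (d ^+ 2) (- (b * c))); ring.
- by apply: (sqr0 _ (- (b * e)) (e ^+ 2) (b ^+ 2)); ring.
- by apply: (sqr0 _ (- (c * f)) (f ^+ 2) (c ^+ 2)); ring.
- by apply: (sqr0 _ (c * e) (d ^+ 2) (- (b * c))); ring.
Qed.

Lemma square_zero_family2 (T : Type) (M : T -> 'M[k]_2) :
    (forall a b, M a *m M b = 0) ->
  exists c p q, forall a, M a = c a *: nilpotent2 p q.
Proof.
move=> MM; have M11 a := (square_zero_mx2 (MM a a)).1.
have M00 a := (square_zero_mx2 (MM a a)).2.
have [[a0 b0]|nb] := pselect (exists a, M a 0 1 != 0).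
  (* The vector [(p, q)] spans the kernel of [M a0], which contains the columns of every [M a].
     Taking [p = 1] makes the top right entry of [nilpotent2 p q] equal to 1. *)
  exists (fun a => M a 0 1), 1, (- (M a0 0 0 / M a0 0 1)) => a.
  have E j : M a0 0 0 * M a 0 j + M a0 0 1 * M a 1 j = 0.
    by rewrite -mulmx2E MM mxE.
  have E1 j : M a 1 j = - (M a0 0 0 / M a0 0 1) * M a 0 j.
    apply: (mulfI b0); apply/eqP; rewrite -subr_eq0 -(E j) addrC.
    by apply/eqP; field.
  have E0 : M a 0 0 = M a0 0 0 / M a0 0 1 * M a 0 1.
    by apply: oppr_inj; rewrite -M11 E1 mulNr.
  by apply: mx2P; rewrite !mxE /= ?E1 ?E0; ring.
have b0 a : M a 0 1 = 0 by apply: contrapT => /eqP ba; apply: nb; exists a.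
have a0 a : M a 0 0 = 0.
  by move/eqP: (M00 a); rewrite b0 mul0r addr0 expf_eq0 => /eqP.
exists (fun a => - M a 1 0), 0, 1 => a.
by apply: mx2P; rewrite !mxE /= ?M11 ?a0 ?b0; ring.
Qed.

End Nilpotent2Field.

(** * Two distinct loops *)

Section TwoArrows.
Variables (k : closedFieldType) (Q : quiver) (I : ideal (path_algebra k Q)).
Variables (N : nat) (x0 : vertex Q) (a b : arrow Q).
Hypothesis sNI : paths_ge N `<=` ideal_set I.
Hypothesis sI2 : ideal_set I `<=` paths_ge 2.
Hypothesis one_vertex : forall x y : vertex Q, x = y.
Hypothesis ab : a != b.

Local Notation rep_const n := (@rep_space k Q (fun=> n)).
Local Notation X n := (@rep_variety k Q I (fun=> n)).

(** In size 2, nilpotency of the arrow matrices and of their pairwise products forces all these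
    products to vanish. *)
Lemma module2P (M : rep_const 2%N) : X 2%N M <->
  exists c p q, forall a', M a' = c a' *: nilpotent2 p q.
Proof.
split=> [XM|[c [p [q ME]]]].
  apply: (@square_zero_family2 _ _ (M : arrow Q -> 'M_2)) => a1 a2.
  have sqr0 (A : 'M[k]_2) : A ^+ N = 0 -> A *m A = 0.
    by move/nilpotent_mx_size; rewrite expr2.
  by apply: square_zero_mulmx2; apply: sqr0;
    [apply: (module_arrowX x0 sNI one_vertex _ XM) ..
    |apply: (module_arrowMX x0 sNI one_vertex _ _ XM)].
apply: (square_zero_module sI2 one_vertex) => a1 a2.
by rewrite !ME -scalemxAl -scalemxAr nilpotent2_square !scaler0.
Qed.

(** The variety is the image of the affine space of parameters [(c, p, q)]; lines there give
    polynomial curves, with denominator 1. *)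
Lemma module2_irreducible : irreducible_set (X 2%N).
Proof.
apply: irreducible_of_curves.
  exists (fun=> 0); apply/module2P; exists (fun=> 0), 0, 0 => a'.
  by rewrite scale0r.
move=> M M' /module2P[c [p [q ME]]] /module2P[c' [p' [q' ME']]].
pose l (x y : k) : {poly k} := x%:P + (y - x) *: 'X.
have l0 x y : (l x y).[0] = x.
  by rewrite /l hornerD hornerC hornerZ hornerX mulr0 addr0.
have l1 x y : (l x y).[1] = y.
  by rewrite /l hornerD hornerC hornerZ hornerX mulr1 addrC subrK.
pose C a' := l (c a') (c' a') *: nilpotent2 (l p p') (l q q').
have CE t a' : map_mx (horner_eval t) (C a') =
    (l (c a') (c' a')).[t] *: nilpotent2 (l p p').[t] (l q q').[t].
  apply/matrixP => i j; rewrite !mxE /horner_eval !hornerM.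
  by case: ifP; case: ifP => _ _; rewrite ?hornerN.
exists (fun t a' => map_mx (horner_eval t) (C a')), 1.
exists (fun i => let u := enum_val i in C (tag u) (tagged u).1 (tagged u).2).
exists 0, 1; split; rewrite ?hornerC ?oner_neq0 //.
- by apply: functional_extensionality_dep => a'; rewrite CE !l0 ME.
- by apply: functional_extensionality_dep => a'; rewrite CE !l1 ME'.
move=> t _; split.
  apply/module2P; exists (fun a' => (l (c a') (c' a')).[t]).
  by exists (l p p').[t], (l q q').[t] => a'; rewrite CE.
by move=> i; rewrite /coordinates mxE hornerC divr1.
Qed.

(** Here [nilpotent2 1 0] is the matrix unit with its 1 in the top right corner. *)
Definition pencil_rep (s t : k) : rep_const 2%N := fun a' =>
  (if a' == a then s else if a' == b then t else 0) *: nilpotent2 1 0.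

Lemma pencil_rep_module s t : X 2%N (pencil_rep s t).
Proof. by apply/module2P; eexists; exists 1, 0 => a'. Qed.

(** A point of a dense orbit satisfies a nontrivial linear relation between its matrices at [a] and
    [b]. This relation is closed and invariant under conjugation, so it would hold on the whole
    variety, but the pencil violates it. *)
Lemma two_arrows_not_discrete : ~ discrete_general_rep_type I.
Proof.
move=> /(_ (fun=> 2%N) (X 2%N))[].
  split=> //; first exact: module2_irreducible.
  by move=> Z' _ ZX XZ; apply/seteqP.
move=> M [/module2P[c [p [q ME]]] _ dense].
have [[s t] st_neq0 st] : exists2 st : k * k, st != 0 &
    st.1 *: (M a : 'M_2) = st.2 *: (M b : 'M_2).
  (* If both multiples are zero, the pair [(c b, c a)] is zero and another one has to be chosen. *)
  have [/andP[/eqP ca /eqP cb]|nc] := boolP ((c a == 0) && (c b == 0)).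
    exists (1, 0); first by rewrite xpair_eqE oner_eq0.
    by rewrite !ME ca cb !scale0r !scaler0.
  exists (c b, c a); first by rewrite xpair_eqE andbC.
  by rewrite !ME !scalerA mulrC.
pose P : set (rep_const 2%N -> k) := [set h | exists i j : 'I_2,
  h = fun M' => s * (M' a : 'M_2) i j + - t * (M' b : 'M_2) i j].
have closedF : zariski_closed [set M' | forall h, P h -> h M' = 0].
  apply: zariski_closed_zeros => _ [i [j ->]].
  apply: polynomial_funD; apply: polynomial_funM;
    by [apply: polynomial_fun_cst | apply: polynomial_fun_entry].
have /(_ closedF) sub := dense [set M' | forall h, P h -> h M' = 0].
have {sub} XF : X 2%N `<=` [set M' | forall h, P h -> h M' = 0].
  apply: sub => M' [g [gU ME']] _ [i [j ->]].
  have gE x : (g x : 'M_2) = g x0 by rewrite (one_vertex x x0).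
  have M'E a' : M' a' = (g x0 : 'M_2) *m (M a' : 'M_2) *m invmx (g x0 : 'M_2).
    by rewrite ME' !gE.
  have : s *: (M' a : 'M_2) = t *: (M' b : 'M_2).
    have lin (u : k) (A : 'M_2) G H : u *: (G *m A *m H) = G *m (u *: A) *m H.
      by rewrite -scalemxAr -scalemxAl.
    by rewrite !M'E !lin st.
  by move/matrixP/(_ i j); rewrite !mxE => ->; rewrite mulNr subrr.
have pencil0 u v : s * u - t * v = 0.
  have := XF _ (@pencil_rep_module u v) _ (ex_intro _ 0 (ex_intro _ 1 erefl)).
  rewrite /pencil_rep eqxx [b == a]eq_sym (negPf ab) eqxx !mxE /=.
  by rewrite !mulr1 mulNr.
have := pencil0 1 0; have := pencil0 0 1.
rewrite !mulr0 !mulr1 subr0 sub0r => /eqP; rewrite oppr_eq0 => /eqP t0 s0.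
by move: st_neq0; rewrite s0 t0 eqxx.
Qed.

(** Two nonzero summands would have dimension 1, where nilpotent matrices are zero, whereas [a] acts
    by a nonzero matrix. *)
Lemma pencil_rep_indecomposable t : indecomposable I (Rep (pencil_rep 1 t)).
Proof.
split=> [/(_ x0)//|[d1 M1] [d2 M2] mod1 mod2].
have d1E := dim_const x0 one_vertex d1; move: (d1 x0) d1E => n1 d1E; subst d1.
have d2E := dim_const x0 one_vertex d2; move: (d2 x0) d2E => n2 d2E; subst d2.
move=> [f [g [gf fg fM]]]; rewrite /rep_zero /=.
have dimE : 2%N = (n1 + n2)%N.
  apply/eqP; rewrite eqn_leq.
  by rewrite (mulmx1_min (gf x0)) (mulmx1_min (fg x0)).
have [->|n1_gt0] := posnP n1; first by left.
have [->|n2_gt0] := posnP n2; first by right.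
have n1E : n1 = 1%N by lia.
have n2E : n2 = 1%N by lia.
subst n1 n2; exfalso.
have mod0 (M : rep_const 1%N) : X 1%N M -> (M a : 'M_1) = 0.
  move/(module_arrowX x0 sNI one_vertex a)/nilpotent_mx_size.
  by rewrite expr1.
have := fM a; rewrite /= (mod0 M1 mod1) (mod0 M2 mod2) block_mx0 mul0mx.
move/(congr1 (mulmx (g (hd a)))); rewrite mulmxA gf mul1mx mulmx0.
move/matrixP/(_ 0 1)/eqP; rewrite /pencil_rep eqxx scale1r !mxE /=.
by rewrite mulr1 oner_eq0.
Qed.

(** At [a], an isomorphism commutes with the matrix unit [K]; at [b], it then identifies [s *: K]
    with [t *: K] after cancellation. *)
Lemma pencil_rep_inj s t :
  rep_iso (Rep (pencil_rep 1 s)) (Rep (pencil_rep 1 t)) -> s = t.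
Proof.
move=> [f [g [gf fg fM]]].
have fE x : (f x : 'M_2) = f x0 by rewrite (one_vertex x x0).
pose K := nilpotent2 (1 : k) 0.
have pa u : pencil_rep 1 u a = K by rewrite /pencil_rep eqxx scale1r.
have pb u : pencil_rep 1 u b = u *: K.
  by rewrite /pencil_rep eq_sym (negPf ab) eqxx.
have fK : (f x0 : 'M_2) *m K = K *m (f x0 : 'M_2).
  by have := fM a; rewrite /= !fE !pa.
have : s *: ((f x0 : 'M_2) *m K) = t *: ((f x0 : 'M_2) *m K).
  by have := fM b; rewrite /= !fE !pb -scalemxAr -scalemxAl -fK.
move/(congr1 (mulmx (g x0 : 'M_2))); rewrite -!scalemxAr mulmxA.
rewrite [_ *m f x0]gf mul1mx => /matrixP/(_ 0 1).
by rewrite !mxE /= !mulr1.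
Qed.

(** Choosing for each [t] an index in the finite list would inject the field into a finite type. *)
Lemma two_arrows_not_representation_finite : ~ representation_finite I.
Proof.
move=> [n [W Wall]].
have Wt t : exists i, rep_iso (Rep (pencil_rep 1 t)) (W i).
  by apply: Wall; [apply: pencil_rep_module|apply: pencil_rep_indecomposable].
apply: (@no_injection_to_fintype _ _ (fun t => sval (cid (Wt t)))) => s t E.
apply: pencil_rep_inj; apply: rep_iso_trans (svalP (cid (Wt s))) _.
by rewrite E; apply: rep_iso_sym (svalP (cid (Wt t))).
Qed.

End TwoArrows.

Theorem proposition2p15 (k : closedFieldType) (Q : quiver)
    (I : ideal (path_algebra k Q)) (I_admissible : admissible I)
    (A_fin_dim : finite_dimensional (quotient_algebra I))
    (A_local : local_ring (quotient_algebra I)) :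
  discrete_general_rep_type I <-> representation_finite I.
Proof.
have [x0 _] := local_vertex A_local.
have one_vertex := local_one_vertex I_admissible A_local.
have [N [N2 sNI sI2]] := I_admissible; have N_gt0 := ltnW N2.
have [one_arrow|] := pselect (forall a b : arrow Q, a = b).
  split=> _.
    exact: (one_arrow_representation_finite x0 N_gt0 sNI one_vertex one_arrow).
  exact: (one_arrow_discrete x0 N_gt0 sNI one_vertex one_arrow).
move=> /existsNP[a /existsNP[b /eqP ab]]; split=> H; exfalso.
  exact: (two_arrows_not_discrete x0 sNI sI2 one_vertex ab) H.
exact: (two_arrows_not_representation_finite x0 sNI sI2 one_vertex ab) H.
Qed.
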